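(* Let $R$ be an arithmetical ring. If $P$ is a maximal ideal of $R$ such that $P^n$ is finitely generated for some integer $n>0$, then $P$ is finitely generated.
   Context: All rings are commutative with identity. A ring is a chain ring if its lattice of ideals is totally ordered by inclusion. A ring $R$ is arithmetical if the localization $R_P$ is a chain ring for each maximal ideal $P$ of $R$. *)

(* Defs.v *)
From HB Require Import structures.
From mathcomp Require Import all_boot all_order all_algebra generic_quotient.
From mathcomp Require Import boolp classical_sets.
From mathcomp Require Import ring.

Set Implicit Arguments.
Unset Strict Implicit.
Unset Printing Implicit Defensive.

Import GRing.Theory.
Local Open Scope classical_set_scope.
Local Open Scope quotient_scope.
Local Open Scope ring_scope.

(* Ideals are Prop-valued sets rather than the [idealr] of [ring_quotient],   *)
(* which is restricted to proper ideals given by a boolean predicate. The     *)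
(* rings are [comPzRingType]s, so the zero ring is not excluded.              *)
Section Ideals.
Variable R : comPzRingType.
Implicit Types I J P : set R.

Definition is_ideal I : Prop :=
  [/\ I 0, forall x y, I x -> I y -> I (x + y) & forall a x, I x -> I (a * x)].

Definition ideal_gen (A : set R) : set R := smallest is_ideal A.

Definition finitely_generated I : Prop :=
  exists s : seq R, I = ideal_gen [set` s].

Definition ideal_mul I J : set R :=
  ideal_gen [set z | exists x y, [/\ I x, J y & z = x * y]].

Definition ideal_exp I (n : nat) : set R := iter n (ideal_mul I) setT.

Definition maximal_ideal P : Prop :=
  [/\ is_ideal P, P <> setT &
      forall J, is_ideal J -> P `<=` J -> J = P \/ J = setT].

Definition prime_ideal P : Prop :=
  [/\ is_ideal P, P <> setT & forall x y, P (x * y) -> P x \/ P y].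

Lemma maximal_prime P : maximal_ideal P -> prime_ideal P.
Proof.
move=> [[P0 PD PM] PT Pmax]; split=> // x y Pxy.
have [Px|nPx] := pselect (P x); [by left | right].
pose J : set R := [set z | exists a p, P p /\ z = a * x + p].
have Jid : is_ideal J.
  split; first by exists 0, 0; rewrite mul0r addr0.
    move=> _ _ [a [p [Pp ->]]] [b [q [Pq ->]]].
    by exists (a + b), (p + q); split; [exact: PD | rewrite mulrDl addrACA].
  move=> c _ [a [p [Pp ->]]].
  by exists (c * a), (c * p); split; [exact: PM | rewrite mulrDr mulrA].
have PJ : P `<=` J by move=> p Pp; exists 0, p; rewrite mul0r add0r.
have Jx : J x by exists 1, 0; rewrite mul1r addr0.
case: (Pmax J Jid PJ) => [JP|JT]; first by case: nPx; rewrite -JP.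
have [a [p [Pp e1]]] : J 1 by rewrite JT.
have -> : y = a * (x * y) + y * p.
  by rewrite mulrA (mulrC y p) -mulrDl -e1 mul1r.
by apply: PD; apply: PM.
Qed.

Definition chain_ring : Prop :=
  forall I J, is_ideal I -> is_ideal J -> I `<=` J \/ J `<=` I.

Definition mult_closed (S : set R) : Prop :=
  S 1 /\ forall x y, S x -> S y -> S (x * y).

Lemma prime_compl P : prime_ideal P -> mult_closed (~` P).
Proof.
move=> [[_ _ PM] PT Pp]; split=> [P1|x y nPx nPy /Pp[]//].
apply: PT; apply/seteqP; split=> // x _.
by rewrite -[x]mulr1; apply: PM.
Qed.

End Ideals.

(* The ring of fractions S^-1 R: a pair (a, s) stands for a / s, and          *)
(* a / s = b / t iff u (a t - b s) = 0 for some u in S.                       *)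
Section Localization.
Variables (R : comPzRingType) (S : set R) (HS : mult_closed S).

Local Notation denom := (set_type S).

Definition mkden s (Ss : S s) : denom := SigSub (mem_set Ss).
Definition den (s : denom) : R := val s.

Lemma denP (s : denom) : S (den s).
Proof. exact: (set_mem (valP s)). Qed.

Definition den1 : denom := mkden (HS.1).
Definition denM (s t : denom) : denom :=
  mkden (HS.2 _ _ (denP s) (denP t)).

Lemma denE : (den den1 = 1) * (forall s t, den (denM s t) = den s * den t).
Proof. by []. Qed.

Definition sfrac : Type := (R * denom)%type.
HB.instance Definition _ := Choice.on sfrac.
Implicit Types x y z : sfrac.

Definition frac_eqv x y : bool :=
  `[< exists2 u, S u & u * (x.1 * den y.2 - y.1 * den x.2) = 0 >].

Lemma frac_eqvP x y :
  reflect (exists2 u, S u & u * (x.1 * den y.2 - y.1 * den x.2) = 0)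
          (frac_eqv x y).
Proof. exact: asboolP. Qed.

Lemma frac_eqv_refl : reflexive frac_eqv.
Proof.
move=> x; apply/frac_eqvP; exists 1; first exact: HS.1.
by rewrite subrr mulr0.
Qed.

Lemma frac_eqv_sym : symmetric frac_eqv.
Proof.
suff sub x y : frac_eqv x y -> frac_eqv y x by move=> x y; apply/idP/idP; apply: sub.
case/frac_eqvP=> u Su e; apply/frac_eqvP; exists u => //.
by rewrite -opprB mulrN e oppr0.
Qed.

Lemma frac_eqv_trans : transitive frac_eqv.
Proof.
move=> y x z /frac_eqvP[u Su e] /frac_eqvP[v Sv f]; apply/frac_eqvP.
exists (u * v * den y.2).
  by do 2?apply: HS.2 => //; exact: denP.
transitivity (v * den z.2 * (u * (x.1 * den y.2 - y.1 * den x.2))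
            + u * den x.2 * (v * (y.1 * den z.2 - z.1 * den y.2))); first by ring.
by rewrite e f !mulr0 addr0.
Qed.

Canonical frac_eqv_equiv :=
  EquivRel frac_eqv frac_eqv_refl frac_eqv_sym frac_eqv_trans.

Definition localization : Type := {eq_quot frac_eqv}.
HB.instance Definition _ : EqQuotient _ frac_eqv localization :=
  EqQuotient.on localization.
HB.instance Definition _ := Choice.on localization.

Definition frac0 : sfrac := (0, den1).
Definition frac1 : sfrac := (1, den1).
Definition fracD x y : sfrac :=
  (x.1 * den y.2 + y.1 * den x.2, denM x.2 y.2).
Definition fracN x : sfrac := (- x.1, x.2).
Definition fracM x y : sfrac := (x.1 * y.1, denM x.2 y.2).

Definition loc0 : localization := \pi_localization frac0.
Definition loc1 : localization := \pi_localization frac1.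
Definition locD := lift_op2 localization fracD.
Definition locN := lift_op1 localization fracN.
Definition locM := lift_op2 localization fracM.

Lemma frac_eqv_repr x : frac_eqv x (repr (\pi_localization x)).
Proof. by apply/eqmodP; rewrite reprK. Qed.

Lemma pi_locD : {morph \pi : x y / fracD x y >-> locD x y}.
Proof.
move=> x y; unlock locD; apply/eqmodP.
have /frac_eqvP[u Su e] := frac_eqv_repr x.
have /frac_eqvP[v Sv f] := frac_eqv_repr y.
set x' := repr _ in e *; set y' := repr _ in f *.
apply/frac_eqvP; exists (u * v); first exact: HS.2.
rewrite /fracD /=; transitivity
  (v * den y.2 * den y'.2 * (u * (x.1 * den x'.2 - x'.1 * den x.2))
 + u * den x.2 * den x'.2 * (v * (y.1 * den y'.2 - y'.1 * den y.2))).
  by rewrite /= ?denE; ring.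
by rewrite e f !mulr0 addr0.
Qed.
Canonical pi_locD_morph := PiMorph2 pi_locD.

Lemma pi_locN : {morph \pi : x / fracN x >-> locN x}.
Proof.
move=> x; unlock locN; apply/eqmodP.
have /frac_eqvP[u Su e] := frac_eqv_repr x.
set x' := repr _ in e *; apply/frac_eqvP; exists u => //.
rewrite /fracN /=.
transitivity (- (u * (x.1 * den x'.2 - x'.1 * den x.2))); first by ring.
by rewrite e oppr0.
Qed.
Canonical pi_locN_morph := PiMorph1 pi_locN.

Lemma pi_locM : {morph \pi : x y / fracM x y >-> locM x y}.
Proof.
move=> x y; unlock locM; apply/eqmodP.
have /frac_eqvP[u Su e] := frac_eqv_repr x.
have /frac_eqvP[v Sv f] := frac_eqv_repr y.
set x' := repr _ in e *; set y' := repr _ in f *.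
apply/frac_eqvP; exists (u * v); first exact: HS.2.
rewrite /fracM /=; transitivity
  (v * y.1 * den y'.2 * (u * (x.1 * den x'.2 - x'.1 * den x.2))
 + u * x'.1 * den x.2 * (v * (y.1 * den y'.2 - y'.1 * den y.2))).
  by rewrite /= ?denE; ring.
by rewrite e f !mulr0 addr0.
Qed.
Canonical pi_locM_morph := PiMorph2 pi_locM.

Lemma pi_eq x y :
  x.1 * den y.2 = y.1 * den x.2 -> \pi_localization x = \pi_localization y.
Proof.
move=> e; apply/eqmodP/frac_eqvP; exists 1; first exact: HS.1.
by rewrite e subrr mulr0.
Qed.

Lemma locDA : associative locD.
Proof.
elim/quotW=> x; elim/quotW=> y; elim/quotW=> z; rewrite -!pi_locD.
by apply: pi_eq; rewrite /= ?denE; ring.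
Qed.

Lemma locDC : commutative locD.
Proof.
elim/quotW=> x; elim/quotW=> y; rewrite -!pi_locD.
by apply: pi_eq; rewrite /= ?denE; ring.
Qed.

Lemma loc0D : left_id loc0 locD.
Proof.
elim/quotW=> x; rewrite /loc0 -pi_locD.
by apply: pi_eq; rewrite /= ?denE; ring.
Qed.

Lemma locND : left_inverse loc0 locN locD.
Proof.
elim/quotW=> x; rewrite /loc0 -pi_locN -pi_locD.
by apply: pi_eq; rewrite /= ?denE; ring.
Qed.

HB.instance Definition _ :=
  GRing.isZmodule.Build localization locDA locDC loc0D locND.

Lemma locMA : associative locM.
Proof.
elim/quotW=> x; elim/quotW=> y; elim/quotW=> z; rewrite -!pi_locM.
by apply: pi_eq; rewrite /= ?denE; ring.
Qed.

Lemma locMC : commutative locM.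
Proof.
elim/quotW=> x; elim/quotW=> y; rewrite -!pi_locM.
by apply: pi_eq; rewrite /= ?denE; ring.
Qed.

Lemma loc1M : left_id loc1 locM.
Proof.
elim/quotW=> x; rewrite /loc1 -pi_locM.
by apply: pi_eq; rewrite /= ?denE; ring.
Qed.

Lemma locMDl : left_distributive locM locD.
Proof.
elim/quotW=> x; elim/quotW=> y; elim/quotW=> z; rewrite -!(pi_locM, pi_locD).
by apply: pi_eq; rewrite /= ?denE; ring.
Qed.

HB.instance Definition _ :=
  GRing.Zmodule_isComPzRing.Build localization locMA locMC loc1M locMDl.

End Localization.

Definition localization_at (R : comPzRingType) (P : set R)
    (HP : prime_ideal P) : comPzRingType :=
  localization (prime_compl HP).

Definition arithmetical (R : comPzRingType) : Prop :=
  forall (P : set R) (HP : maximal_ideal P),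
    chain_ring (localization_at (maximal_prime HP)).

(* Main.v *)
Require Import Defs.
From mathcomp Require Import all_boot all_algebra.
From mathcomp Require Import boolp classical_sets.
From mathcomp Require Import generic_quotient ring.

(** If no single element of P generates P locally at P, then comparability of
    elements in the chain ring R_P gives P = P^2, so P = P^n is finitely
    generated. Otherwise some a in P generates P locally; as P is maximal, every
    t outside P is invertible modulo P^n, whence P = Ra + P^n. *)

Set Implicit Arguments.
Unset Strict Implicit.
Unset Printing Implicit Defensive.

Import GRing.Theory.
Local Open Scope classical_set_scope.
Local Open Scope quotient_scope.
Local Open Scope ring_scope.

Section Ideals.
Variable R : comPzRingType.
Implicit Types I J P A : set R.

Lemma ideal_gen_is_ideal A : is_ideal (ideal_gen A).
Proof.
split=> [I [[]] //|x y Ax Ay I|c x Ax I] [Iid AI]; have [_ ID IM] := Iid.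
  by apply: ID; [exact: Ax | exact: Ay].
by apply: IM; exact: Ax.
Qed.

Lemma ideal_mul_mem I J x y : I x -> J y -> ideal_mul I J (x * y).
Proof. by move=> Ix Jy K [_]; apply; exists x, y. Qed.

Lemma ideal_mul_subl I J : is_ideal I -> ideal_mul I J `<=` I.
Proof.
move=> Iid; apply: smallest_sub => // _ [x [y [Ix _ ->]]].
by have [_ _ IM] := Iid; rewrite mulrC; apply: IM.
Qed.

Lemma principal_is_ideal (x : R) : is_ideal [set y | exists c, y = c * x].
Proof.
split; first by exists 0; rewrite mul0r.
  by move=> _ _ [a ->] [b ->]; exists (a + b); rewrite mulrDl.
by move=> a _ [b ->]; exists (a * b); rewrite mulrA.
Qed.

Lemma chain_ring_dvd : chain_ring R ->
  forall x y : R, (exists c, x = c * y) \/ (exists c, y = c * x).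
Proof.
move=> Rchain x y.
case: (Rchain _ _ (principal_is_ideal x) (principal_is_ideal y)) => sub.
  by left; apply: sub; exists 1; rewrite mul1r.
by right; apply: sub; exists 1; rewrite mul1r.
Qed.

Lemma maximal_ideal_bezout P t : maximal_ideal P -> ~ P t ->
  exists r q, P q /\ 1 = r * t + q.
Proof.
move=> [[P0 PD PM] _ Pmax] nPt.
pose J : set R := [set z | exists r q, P q /\ z = r * t + q].
have Jid : is_ideal J.
  split; first by exists 0, 0; rewrite mul0r addr0.
    move=> _ _ [a [p [Pp ->]]] [b [q [Pq ->]]].
    by exists (a + b), (p + q); split; [exact: PD | ring].
  move=> c _ [a [p [Pp ->]]].
  by exists (c * a), (c * p); split; [exact: PM | ring].
have PJ : P `<=` J by move=> p Pp; exists 0, p; rewrite mul0r add0r.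
case: (Pmax J Jid PJ) => [JP|JT].
  by case: nPt; rewrite -JP; exists 1, 0; rewrite mul1r addr0.
by have : J 1 by rewrite JT.
Qed.

(** Induction on n, starting from P^0 = R: multiplying the remainder x in P^n by 1 = r' t + q with q
    in P turns it into a multiple of t plus q x, which lies in P^(n+1). *)
Lemma maximal_ideal_exp_bezout P t n : maximal_ideal P -> ~ P t ->
  exists r q, ideal_exp P n q /\ 1 = r * t + q.
Proof.
move=> Pmax nPt; elim: n => [|n [r [x [Px e]]]].
  by exists 0, 1; rewrite mul0r add0r.
have [r' [q [Pq e']]] := maximal_ideal_bezout Pmax nPt.
exists (r + x * r'), (q * x); split; first exact: ideal_mul_mem.
rewrite [LHS]e; transitivity (r * t + x * (r' * t + q)); last by ring.
by rewrite -e' mulr1.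
Qed.

End Ideals.

(** Divisibility between x/1 and y/1 in S^-1 R with denominators cleared, so that the main argument
    never leaves R. *)
Lemma localization_chain_dvd (R : comPzRingType) (S : set R)
    (HS : mult_closed S) : chain_ring (localization HS) ->
  forall x y : R, exists t c, S t /\ (t * x = c * y \/ t * y = c * x).
Proof.
move=> /chain_ring_dvd Sdvd x y.
have clear_den a b : (exists c : localization HS,
    \pi_(localization HS) (a, den1 HS) = c * \pi_(localization HS) (b, den1 HS)) ->
    exists t c, S t /\ t * a = c * b.
  case; elim/quotW => -[c s].
  rewrite -[_ * _]/(locM _ _) -pi_locM => /eqmodP /frac_eqvP[u Su e].
  rewrite /= !denE in e.
  (* The equality a/1 = (c/s)(b/1) means u (a s - c b) = 0 for some u in S. *)
  exists (u * den s), (u * c); split; first by apply: HS.2 => //; exact: denP.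
  by apply/subr0_eq; rewrite -e; ring.
case: (Sdvd (\pi_(localization HS) (x, den1 HS)) (\pi_(localization HS) (y, den1 HS))) => /clear_den [t [c [St e]]];
  by exists t, c; split; auto.
Qed.

Theorem theorem2p3 (R : comPzRingType) (HR : arithmetical R)
    (P : set R) (HP : maximal_ideal P)
    (Hfg : exists n : nat, (0 < n)%N /\ finitely_generated (ideal_exp P n)) :
  finitely_generated P.
Proof.
have Pcmp := localization_chain_dvd (HR P HP).
have [Pid _ _] := HP.
case: Hfg => [[|n] [// _ [s Pns]]].
have PnP : ideal_exp P n.+1 `<=` P by exact: ideal_mul_subl.
have [[a [Pa agen]]|nogen] := pselect (exists a, P a /\
    forall p, P p -> exists t c, ~ P t /\ t * p = c * a).
  exists (a :: s); apply/seteqP; split=> [p Pp|].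
    have [t [c [nPt tp]]] := agen p Pp.
    have [r [q [Pq e]]] := maximal_ideal_exp_bezout n.+1 HP nPt.
    have [_ GD GM] := ideal_gen_is_ideal [set` a :: s].
    (* Multiply 1 = r t + q by p and use t p = c a; as q is in P^(n+1), the term p q lies in the
       ideal generated by [s]. *)
    have -> : p = r * c * a + p * q.
      by rewrite -mulrA -tp mulrA (mulrC p) -mulrDl -e mul1r.
    apply: GD; apply: GM.
      by apply: sub_gen_smallest; rewrite /= mem_head.
    move: q Pq {e}; rewrite Pns; apply: smallest_sub.
      exact: ideal_gen_is_ideal.
    by move=> z sz; apply: sub_gen_smallest; rewrite /= inE sz orbT.
  apply: smallest_sub => // z /=; rewrite inE => /orP[/eqP -> //|sz].
  by apply: PnP; rewrite Pns; apply: sub_gen_smallest.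
(* If this fails for x, then x generates P locally: whenever t x = c p with p in P, the coefficient
   c must lie outside P, so c p = t x expresses p through x. *)
have local_sqr x : P x -> exists t c p, [/\ ~ P t, P c, P p & t * x = c * p].
  move=> Px; apply: contrapT => nsqr; apply: nogen; exists x; split=> // p Pp.
  have [t [c [nPt [tp|tx]]]] := Pcmp p x; first by exists t, c.
  have [Pc|nPc] := pselect (P c); last by exists c, t.
  by case: nsqr; exists t, c, p.
suff PPn : P `<=` ideal_exp P n.+1.
  by exists s; rewrite -Pns; apply/seteqP; split.
(* The base case is not definitional: [ideal_exp P 1] is the product of P and R. *)
elim: n {s Pns PnP} => [|n IHn] x Px; first by rewrite -[x]mulr1; apply: ideal_mul_mem.
have [t [c [p [nPt Pc Pp tx]]]] := local_sqr x Px.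
have [r [q [Pq e]]] := maximal_ideal_bezout HP nPt.
have [_ GD GM] : is_ideal (ideal_exp P n.+2) by exact: ideal_gen_is_ideal.
(* Both c p and q x are products of two elements of P; by induction the second factor is in
   P^(n+1). *)
have -> : x = r * (c * p) + q * x by rewrite -tx mulrA -mulrDl -e mul1r.
by apply: GD; [apply: GM|]; apply: ideal_mul_mem => //; apply: IHn.
Qed.
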